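(* $\mathrm{S}^{\neq}$ is closed under Kleene closure.
   Context: Let $\Gamma=\Sigma\cup\{¢,\$\}$, where ¢ and \$ are left and right end-markers. A PFA $\mathcal{P}=(S,\Sigma,\{\mathsf{A}_\sigma:\sigma\in\Gamma\},F)$ has states $S=\{s_1,\dots,s_n\}$ (start state $s_1$), real stochastic $n\times n$ transition matrices $\mathsf{A}_\sigma$, and accepting states $F$; its acceptance probability on $w\in\Sigma^*$ is $f_{\mathcal{P}}(w)=\sum_{s_i\in F}\mathsf{v}(i)$, where $\mathsf{v}=(1,0,\dots,0)\mathsf{A}_{¢}\mathsf{A}_{w_1}\cdots\mathsf{A}_{w_{|w|}}\mathsf{A}_{\$}$. $\mathrm{S}^{\neq}$ (exclusive stochastic languages) is the class of languages of the form $\{w: f_{\mathcal{P}}(w)\neq\lambda\}$ for some PFA $\mathcal{P}$ and $\lambda\in[0,1]$; it coincides with the class of languages recognized with cutpoint 0 by Kondacs–Watrous QFA's. *)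

(* Defs.v *)
From mathcomp Require Import all_boot all_order all_algebra.
From mathcomp Require Import boolp classical_sets reals.

Set Implicit Arguments.
Unset Strict Implicit.
Unset Printing Implicit Defensive.

Import Order.TTheory GRing.Theory Num.Theory.

Local Open Scope classical_set_scope.
Local Open Scope ring_scope.

Inductive tape_symbol (Sigma : Type) : Type :=
  | LeftEnd
  | Letter of Sigma
  | RightEnd.

Arguments LeftEnd {Sigma}.
Arguments RightEnd {Sigma}.

Definition tape (Sigma : Type) (w : seq Sigma) : seq (tape_symbol Sigma) :=
  LeftEnd :: rcons (map (@Letter Sigma) w) RightEnd.

(* Distributions are row vectors acted on from the right, so a stochastic
   matrix is one whose rows are probability vectors. *)
Definition stochastic (R : realType) (n : nat) (A : 'M[R]_n) : Prop :=
  (forall i j, 0 <= A i j) /\ (forall i, \sum_j A i j = 1).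

(* The states are s_1, ..., s_n with n = pfa_size.+1, indexed from 0, so the
   start state s_1 is ord0. *)
Record pfa (R : realType) (Sigma : finType) : Type := PFA {
  pfa_size : nat;
  pfa_trans : tape_symbol Sigma -> 'M[R]_pfa_size.+1;
  pfa_accept : {set 'I_pfa_size.+1};
  pfa_stochastic : forall s, stochastic (pfa_trans s) }.

Definition pfa_final (R : realType) (Sigma : finType) (P : pfa R Sigma)
    (w : seq Sigma) : 'rV[R]_(pfa_size P).+1 :=
  foldl (fun v s => v *m pfa_trans P s) (delta_mx ord0 ord0) (tape w).

Definition pfa_prob (R : realType) (Sigma : finType) (P : pfa R Sigma)
    (w : seq Sigma) : R :=
  \sum_(i in pfa_accept P) pfa_final P w ord0 i.

Definition exclusive_stochastic (R : realType) (Sigma : finType)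
    (L : set (seq Sigma)) : Prop :=
  exists (P : pfa R Sigma) (lambda : R),
    0 <= lambda <= 1 /\ L = [set w | pfa_prob P w <> lambda].

Definition kleene_closure (Sigma : finType) (L : set (seq Sigma)) :
    set (seq Sigma) :=
  [set w | exists us : seq (seq Sigma),
    (forall u, u \in us -> L u) /\ w = flatten us].

(* Main.v *)
(** A language is exclusive stochastic iff it is the support of a rational
    series [w |-> a M_(w_1) ... M_(w_k) b].  Squaring the series
    [pfa_prob P - lambda] (a Hadamard product, again rational) gives a
    nonnegative series [h] with support [L].  Adding to every letter matrix
    [M_s] the term [b a M_s], which closes the current factor and starts a new
    one, gives a series that sums products [h u_1 ... h u_k] over factorizations
    of its argument, all those into nonempty words included; since nothing can
    cancel, its support is, up to the empty word, the Kleene closure of [L].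
    Conversely, a rational series is realized by a PFA with cutpoint 1/2 on two
    copies of its states: the vector computed by the series is, up to a positive
    factor, the difference of the two halves of the distribution. *)
Require Import Defs.
From mathcomp Require Import all_boot all_order all_algebra.
From mathcomp Require Import boolp classical_sets reals.
From mathcomp Require Import ring lra.

Set Implicit Arguments.
Unset Strict Implicit.
Unset Printing Implicit Defensive.

Import Order.TTheory GRing.Theory Num.Theory.

Local Open Scope classical_set_scope.
Local Open Scope ring_scope.

(** * Matrix products along words, and rational series *)

Section RationalSeries.
Variables (R : realType) (Sigma : finType).
Implicit Types h : seq Sigma -> R.

Lemma mul_mx11 (A B : 'M[R]_1) : (A *m B) 0 0 = A 0 0 * B 0 0.
Proof. by rewrite mxE big_ord1. Qed.

Definition word_mx (T : Type) n (A : T -> 'M[R]_n) (w : seq T) : 'M[R]_n :=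
  \big[mulmx/1%:M]_(s <- w) A s.

Lemma word_mx_nil T n (A : T -> 'M[R]_n) : word_mx A [::] = 1%:M.
Proof. exact: big_nil. Qed.

Lemma word_mx_cons T n (A : T -> 'M[R]_n) s w :
  word_mx A (s :: w) = A s *m word_mx A w.
Proof. exact: big_cons. Qed.

Lemma word_mx_rcons T n (A : T -> 'M[R]_n) w s :
  word_mx A (rcons w s) = word_mx A w *m A s.
Proof.
elim: w => [|t w IHw] /=; last by rewrite !word_mx_cons IHw mulmxA.
by rewrite word_mx_cons !word_mx_nil mulmx1 mul1mx.
Qed.

Lemma word_mx_tape n (A : tape_symbol Sigma -> 'M[R]_n) w :
  word_mx A (tape w) =
    A LeftEnd *m word_mx (fun s => A (Letter s)) w *m A RightEnd.
Proof.
by rewrite /tape word_mx_cons word_mx_rcons mulmxA /word_mx big_map.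
Qed.

Lemma foldl_mulmx T n (A : T -> 'M[R]_n) (v : 'rV[R]_n) w :
  foldl (fun v s => v *m A s) v w = v *m word_mx A w.
Proof.
elim: w v => [|s w IHw] v /=; first by rewrite word_mx_nil mulmx1.
by rewrite IHw word_mx_cons mulmxA.
Qed.

(** Every stochastic matrix fixes the all-ones column, so the total mass of the start vector is
    preserved. *)
Lemma pfa_final_sum (P : pfa R Sigma) w : \sum_i pfa_final P w ord0 i = 1.
Proof.
pose one : 'cV[R]_(pfa_size P).+1 := const_mx 1.
have word1 u : word_mx (pfa_trans P) u *m one = one.
  elim: u => [|s u IHu]; first by rewrite word_mx_nil mul1mx.
  rewrite word_mx_cons -mulmxA IHu; apply/matrixP => i j.
  rewrite !mxE -[RHS](proj2 (pfa_stochastic P s) i).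
  by apply: eq_bigr => k _; rewrite mxE mulr1.
transitivity ((pfa_final P w *m one) 0 0).
  by rewrite mxE; apply: eq_bigr => i _; rewrite [const_mx _ _ _]mxE mulr1.
rewrite /pfa_final foldl_mulmx -mulmxA word1 mxE (bigD1 ord0) //= big1 => [|i].
  by rewrite !mxE !eqxx mulr1 addr0.
by move=> /negbTE i0; rewrite !mxE i0 mul0r.
Qed.

Definition rational_series h : Prop :=
  exists n (a : 'rV[R]_n.+1) (M : Sigma -> 'M[R]_n.+1) (b : 'cV[R]_n.+1),
    forall w, h w = (a *m word_mx M w *m b) 0 0.

Lemma rational_seriesI n (a : 'rV[R]_n) M (b : 'cV[R]_n) h :
  (0 < n)%N -> (forall w, h w = (a *m word_mx M w *m b) 0 0) ->
  rational_series h.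
Proof. by case: n a M b => // n a M b _ hE; exists n, a, M, b. Qed.

Lemma rational_mul h1 h2 : rational_series h1 -> rational_series h2 ->
  rational_series (fun w => h1 w * h2 w).
Proof.
move=> [n1 [a1 [M1 [b1 h1E]]]] [n2 [a2 [M2 [b2 h2E]]]].
(* This is the Kronecker product, encoded as the linear map [V |-> (M1 s)^T V (M2 s)]; it keeps
   outer products [a1^T *m a2] of row vectors in that form. *)
pose N s : 'M[R]_(n1.+1 * n2.+1) :=
  lin_mx (mulmxr (M2 s) \o mulmx (M1 s)^T).
apply: (@rational_seriesI _ (mxvec (a1^T *m a2)) N (mxvec (b1 *m b2^T))^T) => // w.
rewrite h1E h2E.
elim: w a1 a2 {h1E h2E} => [|s w IHw] a1 a2.
  rewrite !word_mx_nil !mulmx1 mxvec_dotmul mulmxA -mulmxA.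
  by rewrite -trmx_mul mul_mx11 [_^T _ _]mxE.
rewrite !word_mx_cons !mulmxA IHw; congr ((_ *m _ *m _) 0 0).
by rewrite mul_vec_lin /= trmx_mul !mulmxA.
Qed.

Lemma rational_add h1 h2 : rational_series h1 -> rational_series h2 ->
  rational_series (fun w => h1 w + h2 w).
Proof.
move=> [n1 [a1 [M1 [b1 h1E]]]] [n2 [a2 [M2 [b2 h2E]]]].
pose N s : 'M[R]_(n1.+1 + n2.+1) := block_mx (M1 s) 0 0 (M2 s).
apply: (@rational_seriesI _ (row_mx a1 a2) N (col_mx b1 b2)) => // w.
rewrite h1E h2E.
elim: w a1 a2 {h1E h2E} => [|s w IHw] a1 a2.
  by rewrite !word_mx_nil !mulmx1 mul_row_col [RHS]mxE.
rewrite !word_mx_cons !mulmxA IHw; congr ((_ *m _ *m _) 0 0).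
by rewrite mul_row_block !mulmx0 addr0 add0r.
Qed.

Lemma rational_nil : rational_series (fun w => (w == [::])%:R).
Proof.
exists 0%N, 1%:M, (fun=> 0), 1%:M => -[|s w].
  by rewrite word_mx_nil !mulmx1 mxE.
by rewrite word_mx_cons mul0mx mulmx0 mul0mx mxE.
Qed.

Lemma rational_pfa (P : pfa R Sigma) (lambda : R) :
  rational_series (fun w => pfa_prob P w - lambda).
Proof.
pose A := pfa_trans P.
(* The final distribution has mass 1, so lowering each weight by [lambda] lowers the value by
   exactly [lambda]. *)
pose b : 'cV[R]__ := \col_i ((i \in pfa_accept P)%:R - lambda).
exists (pfa_size P), (delta_mx ord0 ord0 *m A LeftEnd).
exists (fun s => A (Letter s)), (A RightEnd *m b) => w.
transitivity ((pfa_final P w *m b) 0 0); last first.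
  by rewrite /pfa_final foldl_mulmx word_mx_tape !mulmxA.
rewrite -[X in _ - X]mulr1 -(pfa_final_sum P w) /pfa_prob.
rewrite mxE big_mkcond mulr_sumr -sumrB; apply: eq_bigr => i _.
rewrite [b _ _]mxE mulrBr [lambda * _]mulrC.
by case: (i \in _); rewrite ?mulr1 ?mulr0.
Qed.

(** * Kleene closure of the support of a nonnegative series *)

Lemma kleene_closureP (L : set (seq Sigma)) w : kleene_closure L w <->
  w = [::] \/ exists y z, [/\ w = y ++ z, L y & kleene_closure L z].
Proof.
split=> [[[|u us] [Lus ->]]|]; first by left.
  right; exists u, (flatten us); split=> //.
    by apply: Lus; rewrite mem_head.
  by exists us; split=> // t tus; apply: Lus; rewrite inE tus orbT.
case=> [->|[y [z [-> Ly [us [Lus ->]]]]]]; first by exists [::].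
by exists (y :: us); split=> // t; rewrite inE => /orP[/eqP->//|/Lus].
Qed.

Lemma kleene_closure_cons (L : set (seq Sigma)) s w :
  kleene_closure L (s :: w) ->
  exists y z, [/\ w = y ++ z, L (s :: y) & kleene_closure L z].
Proof.
case=> us [Lus]; elim: us Lus => [|[|t u] us IHus] //= Lus; last first.
  case=> -> ->; exists u, (flatten us); split=> //.
    by apply: Lus; rewrite mem_head.
  by exists us; split=> // v vus; apply: Lus; rewrite inE vus orbT.
by apply: IHus => v vus; apply: Lus; rewrite inE vus orbT.
Qed.

Lemma rational_kleene h : (forall w, 0 <= h w) -> rational_series h ->
  exists2 g, rational_series g &
    [set w | g w <> 0] = kleene_closure [set w | h w <> 0].
Proof.
move=> h_ge0 [n [a [M [b hE]]]]; set L := [set w | h w <> 0].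
have hP w : 0 < h w <-> L w.
  by rewrite lt_def h_ge0 andbT; split=> [/eqP|/eqP].
pose N s := M s + b *m a *m M s.
(* Here [x] is the part of the current factor already read. [c x w] sums the products of [h] over
   the factorizations of [x ++ w] whose first factor has prefix [x] and whose later factors are
   nonempty. *)
pose c x w := (a *m word_mx M x *m word_mx N w *m b) 0 0.
have c_nil x : c x [::] = h x by rewrite /c word_mx_nil mulmx1 hE.
(* The two summands of [N s]: either [s] extends the current factor, or [x] is closed with weight
   [h x] and [s] opens the next one. *)
have c_cons x s w : c x (s :: w) = c (rcons x s) w + h x * c [:: s] w.
  rewrite /c word_mx_cons word_mx_rcons mulmxA mulmxDr !mulmxA mulmxDl mulmxDl.
  rewrite mxE hE word_mx_cons word_mx_nil mulmx1; congr (_ + _).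
  by rewrite -mul_mx11 !mulmxA.
have c_ge0 x w : 0 <= c x w.
  elim: w x => [|s w IHw] x; first by rewrite c_nil.
  by rewrite c_cons addr_ge0 ?mulr_ge0.
have c_gt0 x w : 0 < c x w <->
    exists y z, [/\ w = y ++ z, L (x ++ y) & kleene_closure L z].
  elim: w x => [|s w IHw] x.
    rewrite c_nil hP; split=> [Lx|[y [z [yz Ly _]]]].
      by exists [::], [::]; rewrite !cats0; split=> //; exists [::].
    by case: y yz Ly => //; rewrite cats0.
  have -> : (0 < c x (s :: w)) =
      (0 < c (rcons x s) w) || (0 < h x) && (0 < c [:: s] w).
    rewrite c_cons !lt_def addr_ge0 ?mulr_ge0 // !h_ge0 !c_ge0 !andbT.
    by rewrite paddr_eq0 ?mulr_ge0 // mulf_eq0 negb_and negb_or.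
  split=> [/orP[/IHw|/andP[/hP Lx /IHw]] [y [z [-> Ly Lz]]]|].
  - by exists (s :: y), z; rewrite -cat_rcons.
  - exists [::], (s :: y ++ z); rewrite cats0; split=> //.
    by apply/kleene_closureP; right; exists (s :: y), z.
  case=> [[|t y] [z [/= wE Ly Lz]]]; apply/orP.
    right; apply/andP; split; first by apply/hP; rewrite cats0 in Ly.
    by apply/IHw; apply: kleene_closure_cons; rewrite wE.
  by case: wE Ly => <- wE Ly; left; apply/IHw; exists y, z; rewrite cat_rcons.
(* At the empty word [c] gives [h [::]], which may vanish, whereas the closure always contains that
   word. *)
exists (fun w => c [::] w + (w == [::])%:R).
  apply: rational_add rational_nil; exists n, a, N, b => w.
  by rewrite /c word_mx_nil mulmx1.
apply/seteqP; split=> w /=; rewrite kleene_closureP -/L.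
  case: eqP => [->|_]; first by left.
  rewrite addr0 => /eqP cw; right; apply/(c_gt0 [::]).
  by rewrite lt_def cw c_ge0.
case=> [->|/(c_gt0 [::]) cw]; apply/eqP; rewrite gt_eqF //.
  by rewrite eqxx ltr_wpDl.
by rewrite ltr_wpDr.
Qed.

End RationalSeries.

(** * Stochastic matrices on two copies of the states *)

Section Doubling.
Variables (R : realType) (m : nat).
Let n := m.+1.
Implicit Types X : 'M[R]_n.

(** The summand 1 keeps the scale positive at [X = 0], where the inverse would otherwise be that of
    0, namely 0. *)
Definition doubling_scale X : R :=
  ((n + n)%:R * (1 + \sum_i \sum_j `|X i j|))^-1.

(* Both rows of blocks sum to 1 whatever [X] is, and [doubling_scale] is small
   enough for the entries to be nonnegative. *)
Definition doubling X : 'M[R]_(n + n) :=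
  let K := const_mx (n + n)%:R^-1 in
  let Y := doubling_scale X *: X in
  block_mx (K + Y) (K - Y) (K - Y) (K + Y).

(** Right multiplication by it subtracts the second half of a row vector from the first. *)
Definition doubling_diff : 'M[R]_(n + n, n) := col_mx 1%:M (- 1%:M).

Let sumX_ge0 X : 0 <= \sum_i \sum_j `|X i j|.
Proof. by apply: sumr_ge0 => i _; apply: sumr_ge0. Qed.

Lemma doubling_scale_gt0 X : 0 < doubling_scale X.
Proof. by rewrite invr_gt0 mulr_gt0 ?ltr0n // ltr_wpDr. Qed.

Lemma doubling_scale_le X i j :
  `|doubling_scale X * X i j| <= (n + n)%:R^-1.
Proof.
rewrite normrM gtr0_norm ?doubling_scale_gt0 // /doubling_scale invfM -mulrA.
rewrite ler_piMr ?invr_ge0 ?ler0n // ler_pdivrMl ?mulr1 ?ltr_wpDr //.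
apply: (@le_trans _ _ (\sum_i \sum_j `|X i j|)); last by rewrite lerDr.
rewrite (bigD1 i) //= (bigD1 j) //= -addrA lerDl addr_ge0 ?sumr_ge0 // => k _.
by rewrite sumr_ge0.
Qed.

Lemma doubling_ge0 X i j : 0 <= doubling X i j.
Proof.
have := doubling_scale_le X; rewrite /doubling.
case: (split_ordP i) => i' ->; case: (split_ordP j) => j' -> /(_ i' j');
rewrite ler_norml => /andP[le1 le2];
rewrite ?(block_mxEul, block_mxEur, block_mxEdl, block_mxEdr) !mxE; lra.
Qed.

Lemma doubling_sum1 X i : \sum_j doubling X i j = 1.
Proof.
have half (k : 'I_n -> R) :
    \sum_j ((n + n)%:R^-1 + k j) + \sum_j ((n + n)%:R^-1 - k j) = 1.
  rewrite -big_split (eq_bigr (fun=> (n + n)%:R^-1 *+ 2)) => [|j _] /=; last first.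
    by rewrite mulr2n; ring.
  rewrite sumr_const card_ord -mulrnA -[_ *+ _]mulr_natl mul2n -addnn.
  by rewrite divff // pnatr_eq0.
rewrite big_split_ord /= /doubling.
case: (split_ordP i) => i' ->.
  rewrite -[RHS](half (fun j => doubling_scale X * X i' j)).
  by congr (_ + _); apply: eq_bigr => j _; rewrite ?block_mxEul ?block_mxEur !mxE.
rewrite addrC -[RHS](half (fun j => doubling_scale X * X i' j)).
by congr (_ + _); apply: eq_bigr => j _; rewrite ?block_mxEdl ?block_mxEdr !mxE.
Qed.

Lemma doubling_stochastic X : @stochastic R (m + n).+1 (doubling X).
Proof. by split; [exact: doubling_ge0 | exact: doubling_sum1]. Qed.

(** The constant blocks [K] cancel in the difference of the two block columns, and [Y] is counted
    twice. *)
Lemma mul_doubling_diff X :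
  doubling X *m doubling_diff = (2 * doubling_scale X) *: (doubling_diff *m X).
Proof.
rewrite /doubling /doubling_diff mul_block_col mul_col_mx scale_col_mx.
rewrite !mulmxN !mulmx1 mulNmx mul1mx scalerN.
by congr col_mx; apply/matrixP => i j; rewrite !mxE; ring.
Qed.

Lemma word_mx_doubling (T : Type) (X : T -> 'M[R]_n) w : exists2 c : R, 0 < c &
  word_mx (fun t => doubling (X t)) w *m doubling_diff =
    c *: (doubling_diff *m word_mx X w).
Proof.
elim: w => [|t w [c c0 IHw]].
  by exists 1; rewrite // !word_mx_nil mul1mx mulmx1 scale1r.
exists (c * (2 * doubling_scale (X t))).
  by rewrite !mulr_gt0 ?doubling_scale_gt0.
rewrite !word_mx_cons -mulmxA IHw -scalemxAr [doubling _ *m _]mulmxA.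
by rewrite mul_doubling_diff -scalemxAl scalerA mulmxA.
Qed.

End Doubling.

(** * From rational series back to automata *)

Lemma support_exclusive_stochastic (R : realType) (Sigma : finType)
    (h : seq Sigma -> R) :
  rational_series h -> exclusive_stochastic R [set w | h w <> 0].
Proof.
move=> [m [a [M [b hE]]]]; set n := m.+1.
(* All rows of the left marker's matrix are [a], so the start state yields [a]; all columns of the
   right marker's are [b], so every coordinate ends as [h w]. *)
pose X (t : tape_symbol Sigma) : 'M[R]_n :=
  match t with
  | LeftEnd => const_mx 1 *m a
  | Letter s => M s
  | RightEnd => b *m const_mx 1
  end.
pose F : {set 'I_(m + n).+1} := [set i : 'I_(m + n).+1 | (i < n)%N]%SET.
pose P := @PFA R Sigma (m + n) (fun t => doubling (X t)) F
  (fun t => doubling_stochastic (X t)).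
suff probE w : exists2 c : R, 0 < c & pfa_prob P w = 2^-1 + c * h w.
  exists P, 2^-1; split; first by apply/andP; split; lra.
  apply/seteqP; split=> w /=; have [c c0 ->] := probE w.
    move=> /eqP hw; apply/eqP.
    by rewrite -subr_eq0 addrAC subrr add0r mulf_neq0 // gt_eqF.
  by move=> hw hw0; apply: hw; rewrite hw0 mulr0 addr0.
set v := pfa_final P w : 'rV[R]_(n + n).
have vE : v = delta_mx 0 (lshift n 0) *m
    word_mx (fun t => doubling (X t) : 'M_(n + n)) (tape w).
  have -> : lshift n (0 : 'I_n) = ord0 :> 'I_(m + n).+1 by exact: val_inj.
  by rewrite /v /pfa_final foldl_mulmx.
have [c c0 vD] : exists2 c : R, 0 < c &
    (v *m doubling_diff R m *m const_mx 1 : 'M_1) 0 0 = c * h w.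
  have [c c0 wordD] := word_mx_doubling X (tape w).
  (* The factor [n] comes from summing [n] coordinates all equal to [h w]. *)
  exists (c * n%:R); first by rewrite mulr_gt0 ?ltr0n.
  rewrite vE -[_ *m doubling_diff R m]mulmxA wordD -scalemxAr -scalemxAl mxE.
  rewrite -mulrA; congr (_ * _).
  rewrite mulmxA -rowE rowKu row1 word_mx_tape /= hE.
  have -> : delta_mx 0 (0 : 'I_n) *m
      (const_mx 1 *m a *m word_mx M w *m (b *m const_mx 1))
      = a *m word_mx M w *m b *m const_mx 1 :> 'rV_n.
    rewrite !mulmxA; do 3!congr (_ *m _).
    rewrite -rowE row_const -[RHS]mul1mx; congr (_ *m _).
    by apply/matrixP => i j; rewrite !ord1 !mxE.
  rewrite -[_ *m const_mx 1 *m const_mx 1]mulmxA mul_mx11 mulrC; congr (_ * _).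
  rewrite mxE (eq_bigr (fun=> 1)) ?sumr_const ?card_ord // => i _.
  by rewrite !mxE mulr1.
(* The halves of [v] have sum 1 and difference [c * h w]; the accepting half is therefore
   [1/2 + (c / 2) * h w]. *)
exists (c / 2); first by rewrite divr_gt0.
have probE : pfa_prob P w = \sum_(i < n) v ord0 (lshift n i).
  rewrite /pfa_prob big_mkcond (@big_split_ord _ _ _ n n) /=.
  rewrite [X in _ + X]big1 ?addr0 => [|i _]; last first.
    by rewrite inE /= ltnNge leq_addr.
  by apply: eq_bigr => i _; rewrite inE /= ltn_ord.
have : \sum_(i < n) v ord0 (lshift n i) + \sum_(i < n) v ord0 (rshift n i) = 1.
  by rewrite -(pfa_final_sum P w) (@big_split_ord _ _ _ n n).
have : \sum_(i < n) v ord0 (lshift n i) - \sum_(i < n) v ord0 (rshift n i)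
    = c * h w.
  rewrite -vD -mulmxA mul_col_mx mul1mx mulNmx mul1mx mxE big_split_ord /=.
  rewrite -sumrN; congr (_ + _); apply: eq_bigr => i _.
    by rewrite col_mxEu mxE mulr1.
  by rewrite col_mxEd !mxE mulrN mulr1.
by rewrite probE; lra.
Qed.

Theorem theorem5p3 (R : realType) (Sigma : finType) (L : set (seq Sigma)) :
  exclusive_stochastic R L -> exclusive_stochastic R (kleene_closure L).
Proof.
case=> P [lambda [_ ->]].
have ratP := rational_pfa P lambda.
have [|g ratg gE] := rational_kleene _ (rational_mul ratP ratP).
  by move=> w; rewrite -expr2 sqr_ge0.
suff <- : [set w | g w <> 0] =
    kleene_closure [set w | pfa_prob P w <> lambda].
  exact: support_exclusive_stochastic.
rewrite gE; congr kleene_closure; apply/funext => w.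
congr (~ _); apply/propext; split=> [/eqP|->]; last by rewrite subrr mulr0.
by rewrite mulf_eq0 orbb subr_eq0 => /eqP.
Qed.
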